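(* Let $U$ and $V$ be finite-dimensional vector spaces over $\mathbb{F}_2$, and let $\mathcal{S}$ be a linear subspace of $\mathcal{L}(U,V)$ that has one of Types 1 to 7. Then $\mathcal{L}_{\mathrm{loc}}(\mathcal{S})$ has codimension $1$ in $\mathcal{L}_{\mathrm{rc}}(\mathcal{S})$. Moreover, on the matrix space attached to each type, the following map is an example of a non-local range-compatible linear map (here $M=(m_{i,j})$ denotes the generic matrix of the space, and $n,p\ge 0$): Type 1, on $\mathrm{S}_2(\mathbb{F}_2)\vee \mathrm{M}_{n,p}(\mathbb{F}_2)$: $M\mapsto \begin{bmatrix} m_{1,1}\\ m_{2,2}\\ 0_{n\times 1}\end{bmatrix}$; Type 2, on $\mathrm{S}_3(\mathbb{F}_2)\coprod \mathrm{M}_{3,p}(\mathbb{F}_2)$: $M\mapsto \begin{bmatrix} m_{1,1}\\ m_{2,2}\\ m_{3,3}\end{bmatrix}$; Type 3, on $\mathcal{V}_2\vee \mathrm{M}_{n,p}(\mathbb{F}_2)$: $M\mapsto \begin{bmatrix} 0\\ m_{2,1}+m_{2,2}\\ 0\\ 0_{n\times 1}\end{bmatrix}$; Type 4, on $\mathcal{G}_3\coprod \mathrm{M}_{3,p}(\mathbb{F}_2)$: $M\mapsto \begin{bmatrix} m_{1,1}+m_{1,3}\\ 0\\ 0\end{bmatrix}$; Type 5, on $\mathcal{H}_3\coprod \mathrm{M}_{3,p}(\mathbb{F}_2)$: $M\mapsto \begin{bmatrix} m_{1,1}\\ m_{2,2}\\ m_{3,3}\end{bmatrix}$; Type 6,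 on $\mathcal{I}_3\coprod \mathrm{M}_{3,p}(\mathbb{F}_2)$: $M\mapsto \begin{bmatrix} 0\\ 0\\ m_{1,1}+m_{3,1}\end{bmatrix}$; Type 7, on $\mathcal{H}_4\coprod \mathrm{M}_{3,p}(\mathbb{F}_2)$: $M\mapsto (m_{1,1}+m_{2,1}+m_{3,1})\begin{bmatrix} 1\\ 1\\ 1\end{bmatrix}$.
   Context: $\mathcal{L}(U,V)$ is the space of linear operators from $U$ to $V$; $\mathrm{M}_{n,p}(\mathbb{F}_2)$ is the space of $n\times p$ matrices over $\mathbb{F}_2$ ($n$ or $p$ may be $0$); $\mathrm{S}_n(\mathbb{F}_2)$ is the space of symmetric $n\times n$ matrices. A linear map $F:\mathcal{S}\to V$ is range-compatible when $F(s)\in\operatorname{Im}s$ for all $s\in\mathcal{S}$; it is local when there is a vector $x\in U$ such that $F(s)=s(x)$ for all $s\in\mathcal{S}$. $\mathcal{L}_{\mathrm{rc}}(\mathcal{S})$ denotes the vector space of all range-compatible linear maps on $\mathcal{S}$, and $\mathcal{L}_{\mathrm{loc}}(\mathcal{S})$ its linear subspace of all local maps. The same definitions are used for maps from a linear subspace of $\mathrm{M}_{n,p}(\mathbb{F}_2)$ to $\mathbb{F}_2^n$, by identifying $\mathrm{M}_{n,p}(\mathbb{F}_2)$ with $\mathcal{L}(\mathbb{F}_2^p,\mathbb{F}_2^n)$ through the standard bases. For $\mathcal{A}\subset \mathrm{M}_{m,p}(\mathbb{F}_2)$ and $\mathcal{B}\subset \mathrm{M}_{n,q}(\mathbb{F}_2)$,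 set $$\mathcal{A}\vee\mathcal{B}:=\left\{\begin{bmatrix}A & C\\ 0_{n\times p} & B\end{bmatrix} : A\in\mathcal{A},\ B\in\mathcal{B},\ C\in \mathrm{M}_{m,q}(\mathbb{F}_2)\right\}\subset \mathrm{M}_{m+n,p+q}(\mathbb{F}_2).$$ For $\mathcal{A}\subset \mathrm{M}_{n,p}(\mathbb{F}_2)$ and $\mathcal{B}\subset \mathrm{M}_{n,q}(\mathbb{F}_2)$, set $\mathcal{A}\coprod\mathcal{B}:=\{[A\ \ B] : A\in\mathcal{A},\ B\in\mathcal{B}\}\subset \mathrm{M}_{n,p+q}(\mathbb{F}_2)$. Special matrix spaces (all parameters range over $\mathbb{F}_2$): $$\mathcal{V}_2:=\left\{\begin{bmatrix} a&b\\ b&c\\ c&0\end{bmatrix}\right\},\quad \mathcal{G}_3:=\left\{\begin{bmatrix} a&c&b\\ 0&b+c&e\\ b&d&f\end{bmatrix}\right\},\quad \mathcal{H}_3:=\left\{\begin{bmatrix} a&b&c\\ b&d&f\\ c&e&b+c+d\end{bmatrix}\right\},$$ $$\mathcal{I}_3:=\left\{\begin{bmatrix} a&d&e\\ b&c&f\\ c&a&a+c+e+f\end{bmatrix}\right\},\quad \mathcal{H}_4:=\left\{\begin{bmatrix} a&b+c&f&h\\ b&d&a+c&i\\ c&e&g&a+b\end{bmatrix}\right\}.$$ A linear subspace $\mathcal{S}$ of $\mathcal{L}(U,V)$ has Type $i$ when, in some bases of $U$ and $V$, it is represented by the following matrix space: Type 1: $\mathrm{S}_2(\mathbb{F}_2)\vee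 \mathrm{M}_{n,p}(\mathbb{F}_2)$ for some $n\ge0$, $p\ge 0$; Type 2: $\mathrm{S}_3(\mathbb{F}_2)\coprod \mathrm{M}_{3,p}(\mathbb{F}_2)$ for some $p\ge0$; Type 3: $\mathcal{V}_2\vee \mathrm{M}_{n,p}(\mathbb{F}_2)$ for some $n\ge0$, $p\ge 0$; Type 4: $\mathcal{G}_3\coprod \mathrm{M}_{3,p}(\mathbb{F}_2)$ for some $p\ge0$; Type 5: $\mathcal{H}_3\coprod \mathrm{M}_{3,p}(\mathbb{F}_2)$ for some $p\ge0$; Type 6: $\mathcal{I}_3\coprod \mathrm{M}_{3,p}(\mathbb{F}_2)$ for some $p\ge0$; Type 7: $\mathcal{H}_4\coprod \mathrm{M}_{3,p}(\mathbb{F}_2)$ for some $p\ge0$. *)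

(* Defs.v *)
From HB Require Import structures.
From mathcomp Require Import all_boot all_order all_algebra all_field.
Set Implicit Arguments.
Unset Strict Implicit.
Unset Printing Implicit Defensive.
Import GRing.Theory.
Local Open Scope ring_scope.

Section Operators.
Variables (U V : vectType 'F_2) (S : {vspace 'Hom(U, V)}).

Definition range_compatible (F : 'Hom(subvs_of S, V)) : Prop :=
  forall s : subvs_of S, F s \in limg (vsval s).

Definition local_map (F : 'Hom(subvs_of S, V)) : Prop :=
  exists x : U, forall s : subvs_of S, F s = vsval s x.

Definition eval_at (x : U) : 'Hom(subvs_of S, V) :=
  linfun (fun s : subvs_of S => vsval s x).

(* [finvect_type T] is [T] with its finType structure (the field is finite);
   see [mem_Lrc] and [mem_Lloc] for the elements of these two spaces. *)
Definition Lrc : {vspace 'Hom(subvs_of S, V)} :=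
  (\bigcap_(s : finvect_type (subvs_of S))
     linfun (fun F : 'Hom(subvs_of S, V) => F s) @^-1: limg (vsval s))%VS.

Definition Lloc : {vspace 'Hom(subvs_of S, V)} := limg (linfun eval_at).

Lemma mem_Lrc F : F \in Lrc <-> range_compatible F.
Proof.
have evE s G : linfun (fun F : 'Hom(subvs_of S, V) => F s) G = G s.
  have lin : linear (fun F : 'Hom(subvs_of S, V) => F s).
    by move=> a f g; rewrite add_lfunE scale_lfunE.
  pose H := GRing.isLinear.Build _ _ _ _ _ lin.
  pose L : {linear _ -> _} := HB.pack (fun F : 'Hom(subvs_of S, V) => F s) H.
  exact: (lfunE L).
rewrite /Lrc memvE; split.
  by move/subv_bigcapP=> h s; have := h s isT; rewrite -memvE -memv_preim evE.
by move=> h; apply/subv_bigcapP=> s _; rewrite -memvE -memv_preim evE; apply: h.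
Qed.

Lemma eval_atE x s : eval_at x s = vsval s x.
Proof.
have lin : linear (fun s : subvs_of S => vsval s x).
  by move=> a f g; rewrite linearP add_lfunE scale_lfunE.
pose H := GRing.isLinear.Build _ _ _ _ _ lin.
pose L : {linear _ -> _} := HB.pack (fun s : subvs_of S => vsval s x) H.
exact: (lfunE L).
Qed.

Lemma mem_Lloc F : F \in Lloc <-> local_map F.
Proof.
have lin : linear eval_at.
  move=> a x y; apply/lfunP => s.
  by rewrite add_lfunE scale_lfunE !eval_atE linearP.
pose H := GRing.isLinear.Build _ _ _ _ _ lin.
pose L : {linear _ -> _} := HB.pack eval_at H.
split.
  case/memv_imgP=> x _ ->; exists x => s.
  by rewrite (lfunE L) /= eval_atE.
case=> x hx; apply/memv_imgP; exists x; first exact: memvf.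
by apply/lfunP=> s; rewrite (lfunE L) /= eval_atE hx.
Qed.

End Operators.

(* Matrices act on column vectors, so the image of [M] is
   [{M *m x | x : 'cV_p}].  A map on a matrix space [X] is the restriction
   to [X] of a function on all matrices. *)
Section Matrices.
Variables (n p : nat) (X : {set 'M['F_2]_(n, p)}).
Variable F : 'M['F_2]_(n, p) -> 'cV['F_2]_n.

Definition mx_linear_on : Prop :=
  forall a, {in X &, forall M N, F (a *: M + N) = a *: F M + F N}.

Definition mx_range_compatible : Prop :=
  {in X, forall M, exists x : 'cV_p, F M = M *m x}.

Definition mx_local : Prop :=
  exists x : 'cV_p, {in X, forall M, F M = M *m x}.

Definition nonlocal_rc_linear : Prop :=
  [/\ mx_linear_on, mx_range_compatible & ~ mx_local].

End Matrices.

Definition vee m n p q (X : {set 'M['F_2]_(m, p)}) (Y : {set 'M['F_2]_(n, q)}) :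
    {set 'M['F_2]_(m + n, p + q)} :=
  [set M | [exists A in X, exists B in Y, exists C : 'M['F_2]_(m, q),
            M == block_mx A C 0 B]].

Definition mx_coprod n p q (X : {set 'M['F_2]_(n, p)})
    (Y : {set 'M['F_2]_(n, q)}) : {set 'M['F_2]_(n, p + q)} :=
  [set row_mx A B | A in X, B in Y].

Definition full_mx n p : {set 'M['F_2]_(n, p)} := setT.

Definition sym_mx n : {set 'M['F_2]_n} := [set M | M^T == M].

Definition mx_of_rows n p (rows : seq (seq 'F_2)) : 'M['F_2]_(n, p) :=
  \matrix_(i < n, j < p) nth 0 (nth [::] rows i) j.

Definition cV_of n (s : seq 'F_2) : 'cV['F_2]_n := \col_(i < n) nth 0 s i.

Definition V2 : {set 'M['F_2]_(3, 2)} :=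
  [set M | [exists a, exists b, exists c,
    M == mx_of_rows 3 2 [:: [:: a; b];
                            [:: b; c];
                            [:: c; 0]]]].

Definition G3 : {set 'M['F_2]_(3, 3)} :=
  [set M | [exists a, exists b, exists c, exists d, exists e, exists f,
    M == mx_of_rows 3 3 [:: [:: a; c; b];
                            [:: 0; b + c; e];
                            [:: b; d; f]]]].

Definition H3 : {set 'M['F_2]_(3, 3)} :=
  [set M | [exists a, exists b, exists c, exists d, exists e, exists f,
    M == mx_of_rows 3 3 [:: [:: a; b; c];
                            [:: b; d; f];
                            [:: c; e; b + c + d]]]].

Definition I3 : {set 'M['F_2]_(3, 3)} :=
  [set M | [exists a, exists b, exists c, exists d, exists e, exists f,
    M == mx_of_rows 3 3 [:: [:: a; d; e];
                            [:: b; c; f];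
                            [:: c; a; a + c + e + f]]]].

Definition H4 : {set 'M['F_2]_(3, 4)} :=
  [set M | [exists a, exists b, exists c, exists d, exists e, exists f,
            exists g, exists h, exists i,
    M == mx_of_rows 3 4 [:: [:: a; b + c; f; h];
                            [:: b; d; a + c; i];
                            [:: c; e; g; a + b]]]].

(* The entry in row [i], column [j] is the [i]-th coordinate of the image of
   the [j]-th basis vector. *)
Definition mx_in_bases (U V : vectType 'F_2) n p (e : p.-tuple U)
    (f : n.-tuple V) (s : 'Hom(U, V)) : 'M['F_2]_(n, p) :=
  \matrix_(i < n, j < p) coord f i (s e`_j).

Definition represented_by (U V : vectType 'F_2) (S : {vspace 'Hom(U, V)})
    n p (X : {set 'M['F_2]_(n, p)}) : Prop :=
  exists (e : p.-tuple U) (f : n.-tuple V),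
    [/\ basis_of fullv e, basis_of fullv f
      & forall M, M \in X <-> exists2 s, s \in S & mx_in_bases e f s = M].

Section Types.
Variables (U V : vectType 'F_2) (S : {vspace 'Hom(U, V)}).

Definition type1 : Prop :=
  exists n p, represented_by S (vee (sym_mx 2) (full_mx n p)).
Definition type2 : Prop :=
  exists p, represented_by S (mx_coprod (sym_mx 3) (full_mx 3 p)).
Definition type3 : Prop :=
  exists n p, represented_by S (vee V2 (full_mx n p)).
Definition type4 : Prop :=
  exists p, represented_by S (mx_coprod G3 (full_mx 3 p)).
Definition type5 : Prop :=
  exists p, represented_by S (mx_coprod H3 (full_mx 3 p)).
Definition type6 : Prop :=
  exists p, represented_by S (mx_coprod I3 (full_mx 3 p)).
Definition type7 : Prop :=
  exists p, represented_by S (mx_coprod H4 (full_mx 3 p)).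

End Types.

(* [ent M i j] is the entry $m_{i,j}$, with indices counted from 1. *)
Definition ent n p (M : 'M['F_2]_(n.+1, p.+1)) (i j : nat) : 'F_2 :=
  M (inord i.-1) (inord j.-1).

(* Main.v *)
From HB Require Import structures.
Require Import Defs.
From mathcomp Require Import all_boot all_order all_algebra all_field.
From mathcomp Require Import ring.
Set Implicit Arguments.
Unset Strict Implicit.
Unset Printing Implicit Defensive.
Import GRing.Theory passmx.
Local Open Scope ring_scope.

(** Duality turns range-compatibility into a finite linear problem.  For a
    linear map F on a matrix space X and a row vector y, the form M |-> y F(M)
    vanishes whenever y M = 0 as soon as F is range-compatible; hence it
    factors through M |-> y M, that is, y F(M) = y M g for some column g
    depending only on y ([functional_factor]).  Conversely, the existence of
    such a g for every y forces F(M) into the image of M, because a column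
    killed by every y with y M = 0 lies in that image ([col_in_image]).  Local
    maps are those for which one g serves all y.

    Taking for y the unit vectors, a range-compatible linear map on X is given
    by one row of coefficients per row of M: F(M)_i = sum_j G_ij M_ij
    ([rc_rowwise]).  Since changing F by a local map adds one and the same
    vector to all rows of G, the first row of G may be taken to be 0.  For each
    of the seven special spaces at most 2^8 matrices G are left, and whether G
    gives a range-compatible map is decided by testing, on generators of X,
    the existence of a suitable g for each y.  An evaluation of this
    [certificate] shows that such a G is local, or is local up to the example
    G0 of the statement, which itself passes the test and is not local.

    The parameters n and p are absorbed by two reductions.  On a full matrix
    space every range-compatible linear map is local: the vector g attached to
    y = (1 ... 1) works for all the matrices with a single nonzero row, which
    generate the space ([rc_full_mx_local]).  As a map on X coprod Y is the sum
    of its restrictions to X and Y, juxtaposing full columns creates no new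
    class modulo local maps ([one_nonlocal_coprod]).  And X vee M_{n,p} is the
    coproduct of a full space with X padded by n zero rows, on which the last n
    coordinates of a range-compatible map vanish ([one_nonlocal_vee]).

    Finally the choice of bases carries the operator space S to its matrix
    space, and the codimension is 1 because the class of the example spans
    Lrc modulo Lloc ([represented_dim_rc]). *)

(** * Linear algebra over the two-element field *)

(** The image of M is the annihilator of its left kernel; the columns of
    [cokermx M^T] are the vectors y to test. *)
Lemma col_in_image (K : fieldType) n k (M : 'M[K]_(n, k)) (c : 'cV_n) :
  (forall y : 'rV_n, y *m M = 0 -> y *m c = 0) -> exists x, c = M *m x.
Proof.
move=> ker_c; suff /submxP[D defc]: (c^T <= M^T)%MS.
  by exists D^T; apply: trmx_inj; rewrite defc trmx_mul trmxK.
rewrite submxE; apply/eqP/matrixP=> i j; rewrite [RHS]mxE.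
have kerM : (col j (cokermx M^T))^T *m M = 0.
  by apply: trmx_inj; rewrite trmx_mul trmxK colE mulmxA mulmx_coker mul0mx trmx0.
have /matrixP/(_ 0 i) := ker_c _ kerM; rewrite [RHS]mxE; apply: etrans.
by rewrite !mxE; apply: eq_bigr => l _; rewrite !mxE mulrC ord1.
Qed.

Lemma F2_cases (a : 'F_2) : a = 0 \/ a = 1.
Proof. by case: a => [[|[|//]] lt_a]; [left | right]; apply: val_inj. Qed.

Lemma F2_bool (a : 'F_2) : (a != 0)%:R = a.
Proof. by case: (F2_cases a) => ->. Qed.

Lemma natr_addb (a b : bool) : (a (+) b)%:R = a%:R + b%:R :> 'F_2.
Proof. by case: a; case: b; apply: val_inj. Qed.

(** Over the two-element field a set of matrices closed under addition is a
    linear subspace: the only scalars are 0 and 1. *)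
Definition additive_set n k (X : {set 'M['F_2]_(n, k)}) : Prop :=
  0 \in X /\ {in X &, forall M N, M + N \in X}.

Lemma additive_setZ n k (X : {set 'M['F_2]_(n, k)}) a :
  additive_set X -> {in X, forall M, a *: M \in X}.
Proof.
by move=> [X0 _] M XM; case: (F2_cases a) => ->; rewrite ?scale0r ?scale1r.
Qed.

Lemma additive_set_sum n k (X : {set 'M['F_2]_(n, k)}) I (r : seq I)
    (B : I -> 'M_(n, k)) :
  additive_set X -> (forall i, B i \in X) -> \sum_(i <- r) B i \in X.
Proof. by move=> [X0 XD] XB; elim/big_ind: _. Qed.

(** * Factoring range-compatible maps through the rows *)

Section LinearOn.
Variables (n k : nat) (X : {set 'M['F_2]_(n, k)}) (F : 'M['F_2]_(n, k) -> 'cV['F_2]_n).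
Hypotheses (addX : additive_set X) (linF : mx_linear_on X F).

Lemma linear_onD : {in X &, {morph F : M N / M + N}}.
Proof. by move=> M N XM XN; have := linF 1 XM XN; rewrite !scale1r. Qed.

Lemma linear_on0 : F 0 = 0.
Proof.
have [X0 _] := addX; have /eqP := linear_onD X0 X0.
by rewrite addr0 -subr_eq0 opprD addNKr oppr_eq0 => /eqP.
Qed.

Lemma linear_on_sum I (r : seq I) (B : I -> 'M_(n, k)) :
  (forall i, B i \in X) -> F (\sum_(i <- r) B i) = \sum_(i <- r) F (B i).
Proof.
move=> XB; elim: r => [|i r IHr]; first by rewrite !big_nil linear_on0.
by rewrite !big_cons linear_onD ?IHr //; apply: additive_set_sum.
Qed.

Lemma linear_onZ a : {in X, forall M, F (a *: M) = a *: F M}.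
Proof.
by move=> M XM; case: (F2_cases a) => ->; rewrite ?scale0r ?scale1r ?linear_on0.
Qed.

Hypothesis rcF : mx_range_compatible X F.

(** The equations y F(M) = y M g, one for each M in X, form a linear system in
    the unknown g.  A linear relation u between its left-hand sides is y M = 0
    for the combination M of elements of X with coefficients u; then y F(M) = 0
    by range-compatibility, which is the same relation between the right-hand
    sides.  So the system is solvable. *)
Lemma functional_factor (y : 'rV_n) :
  exists g : 'cV_k, {in X, forall M, y *m F M = y *m M *m g}.
Proof.
pose e := @enum_val _ (mem X).
have Xe i : e i \in X by apply: enum_valP.
pose R : 'M['F_2]_(#|X|, k) := \matrix_i (y *m e i).
pose c : 'cV['F_2]_#|X| := \col_i (y *m F (e i)) 0 0.
have [u kerR|g defc] := @col_in_image _ _ _ R c.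
  have XZ i : u 0 i *: e i \in X by apply: additive_setZ.
  pose M := \sum_i u 0 i *: e i.
  have XM : M \in X by apply: additive_set_sum.
  have yM : y *m M = 0.
    rewrite -kerR [RHS]mulmx_sum_row /M mulmx_sumr; apply: eq_bigr => i _.
    by rewrite rowK scalemxAr.
  have [x defFM] := rcF XM.
  have yF : y *m F M = 0 by rewrite defFM mulmxA yM mul0mx.
  rewrite -yF /M linear_on_sum // mulmx_sumr.
  apply/matrixP=> i j; rewrite !ord1 mxE summxE; apply: eq_bigr => l _.
  by rewrite linear_onZ // -scalemxAr !mxE.
exists g => M XM; pose i := enum_rank_in XM M.
have eiM : e i = M by rewrite /e enum_rankK_in.
have /matrixP/(_ i 0) := defc; rewrite mxE eiM => yFM.
apply/matrixP=> r s; rewrite !ord1 yFM !mxE.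
by apply: eq_bigr => l _; rewrite mxE eiM.
Qed.

End LinearOn.

Section Rowwise.
Variables n k : nat.
Implicit Types G M : 'M['F_2]_(n, k).

(** Row i of G acts as a linear form on row i of M: this is the diagonal of
    M *m G^T.  The local map at x is the case where all rows of G are x^T. *)
Definition rowwise G M : 'cV['F_2]_n := \col_i \sum_j G i j * M i j.

Lemma rowwiseDl G G' M : rowwise (G + G') M = rowwise G M + rowwise G' M.
Proof.
apply/colP=> i; rewrite !mxE -big_split.
by apply: eq_bigr => j _; rewrite !mxE mulrDl.
Qed.

Lemma rowwise_is_linear G a M N :
  rowwise G (a *: M + N) = a *: rowwise G M + rowwise G N.
Proof.
apply/colP=> i; rewrite !mxE mulr_sumr -big_split.
by apply: eq_bigr => j _; rewrite !mxE mulrDr mulrCA.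
Qed.

Lemma rowwise_0r G : rowwise G 0 = 0.
Proof. by apply/colP=> i; rewrite !mxE big1 // => j _; rewrite mxE mulr0. Qed.

Lemma rowwise_0l M : rowwise 0 M = 0.
Proof. by apply/colP=> i; rewrite !mxE big1 // => j _; rewrite mxE mul0r. Qed.

Lemma rowwise_linear_on G (X : {set 'M['F_2]_(n, k)}) :
  mx_linear_on X (rowwise G).
Proof. by move=> a M N _ _; apply: rowwise_is_linear. Qed.

Lemma rowwise_const (x : 'rV_k) M : rowwise (\matrix_(i < n) x) M = M *m x^T.
Proof.
by apply/colP=> i; rewrite !mxE; apply: eq_bigr => j _; rewrite !mxE mulrC.
Qed.

(** [functional_factor] at the unit vectors: coordinate i of F(M) depends only
    on row i of M. *)
Lemma rc_rowwise X F : additive_set X -> mx_linear_on X F ->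
  mx_range_compatible X F -> exists G, {in X, forall M, F M = rowwise G M}.
Proof.
move=> addX linF rcF.
have gex i : exists g : 'cV['F_2]_k,
    {in X, forall M, delta_mx 0 i *m F M = (delta_mx 0 i : 'rV_n) *m M *m g}.
  exact: functional_factor.
have [g gP] := fin_all_exists gex.
exists (\matrix_i (g i)^T) => M XM; apply/colP=> i.
have /matrixP/(_ 0 0) := gP i M XM.
rewrite -!rowE !mxE => ->.
by apply: eq_bigr => j _; rewrite !mxE mulrC.
Qed.

End Rowwise.

(** * Coproducts, zero rows, and the full matrix spaces *)

Lemma mem_full_mx n p (M : 'M_(n, p)) : M \in full_mx n p.
Proof. exact: in_setT. Qed.

Lemma full_mx_additive n p : additive_set (full_mx n p).
Proof. by split=> [|M N _ _]; apply: mem_full_mx. Qed.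

(** With y = (1 ... 1) in [functional_factor], y F(M) = y M g.  When only row i
    of M is nonzero, F(M) is a multiple of the i-th basis vector, so its i-th
    coordinate is y F(M), and F(M) = M g.  These matrices generate the space. *)
Lemma rc_full_mx_local n p F : mx_linear_on (full_mx n p) F ->
  mx_range_compatible (full_mx n p) F -> mx_local (full_mx n p) F.
Proof.
move=> linF rcF; have addX := full_mx_additive n p.
have inX := @mem_full_mx n p.
have [g gP] := functional_factor addX linF rcF (const_mx 1).
exists g => M _.
have row_part i : F (delta_mx i 0 *m row i M) = delta_mx i 0 *m (row i M *m g).
  have [x xP] := rcF _ (inX (delta_mx i 0 *m row i M)).
  have := gP _ (inX (delta_mx i 0 *m row i M)); rewrite xP -!mulmxA.
  have one : (const_mx 1 : 'rV_n) *m (delta_mx i 0 : 'cV['F_2]_n) = 1%:M.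
    apply/matrixP=> r s; rewrite !ord1 !mxE (bigD1 i) //= !mxE !eqxx mulr1.
    by rewrite big1 ?addr0 // => j /negPf ne_ji; rewrite !mxE ne_ji mulr0.
  by rewrite !(mulmxA (const_mx 1)) one !mul1mx => ->.
have defM : M = \sum_i delta_mx i 0 *m row i M.
  apply/matrixP=> r s; rewrite summxE (bigD1 r) //= !mxE big_ord1 !mxE !eqxx mul1r.
  rewrite big1 ?addr0 // => i /negPf ne_ir.
  by rewrite mxE big_ord1 !mxE eq_sym ne_ir mul0r.
rewrite [in LHS]defM (linear_on_sum addX linF) //.
under eq_bigr do rewrite row_part mulmxA.
by rewrite -mulmx_suml -defM.
Qed.

(** F0 is not local and, modulo local maps, it is the only nonzero class of
    range-compatible linear maps on X.  This is the matrix form of the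
    codimension 1 statement, with an explicit representative. *)
Definition one_nonlocal_class n k (X : {set 'M['F_2]_(n, k)})
    (F0 : 'M['F_2]_(n, k) -> 'cV['F_2]_n) : Prop :=
  [/\ additive_set X, nonlocal_rc_linear X F0
    & forall F, mx_linear_on X F -> mx_range_compatible X F ->
      exists x, exists a, {in X, forall M, F M = M *m x + a *: F0 M}].

Lemma eq_one_nonlocal_class n k (X : {set 'M['F_2]_(n, k)}) F0 F1 :
  {in X, F0 =1 F1} -> one_nonlocal_class X F0 -> one_nonlocal_class X F1.
Proof.
move=> eqF [addX [linF rcF nlF] clF]; have [X0 XD] := addX.
split=> //; first split.
- by move=> a M N XM XN; rewrite -!eqF ?linF // XD ?additive_setZ.
- by move=> M XM; have [x xP] := rcF M XM; exists x; rewrite -eqF.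
- by case=> x xP; apply: nlF; exists x => M XM; rewrite eqF ?xP.
move=> F linF' rcF'; have [x [a xP]] := clF F linF' rcF'.
by exists x, a => M XM; rewrite xP ?eqF.
Qed.

Lemma mx_coprodP n p q (X : {set 'M['F_2]_(n, p)}) (M : 'M_(n, p + q)) :
  M \in mx_coprod X (full_mx n q) <-> lsubmx M \in X.
Proof.
split=> [/imset2P[A B XA _ ->]|XM]; first by rewrite row_mxKl.
by apply/imset2P; exists (lsubmx M) (rsubmx M); rewrite ?mem_full_mx ?hsubmxK.
Qed.

(** A range-compatible linear map on the coproduct is the sum of its
    restrictions to [A 0] and to [0 B], both range-compatible; the second one
    is local since B ranges over a full matrix space. *)
Lemma one_nonlocal_coprod n p q (X : {set 'M['F_2]_(n, p)}) F0 :
  one_nonlocal_class X F0 ->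
  one_nonlocal_class (mx_coprod X (full_mx n q)) (F0 \o lsubmx).
Proof.
move=> [addX [linF0 rcF0 nlF0] clF0]; have [X0 XD] := addX.
have inl (A : 'M_(n, p)) : A \in X -> row_mx A 0 \in mx_coprod X (full_mx n q).
  by move=> XA; apply/mx_coprodP; rewrite row_mxKl.
have inr (B : 'M_(n, q)) : row_mx 0 B \in mx_coprod X (full_mx n q).
  by apply/mx_coprodP; rewrite row_mxKl.
split; first split.
- by apply/mx_coprodP; rewrite linear0.
- move=> M N /mx_coprodP XM /mx_coprodP XN.
  by apply/mx_coprodP; rewrite linearD XD.
- split.
  + move=> a M N /mx_coprodP XM /mx_coprodP XN /=.
    by rewrite linearP linF0.
  + move=> M /mx_coprodP XM; have [x xP] := rcF0 _ XM.
    by exists (col_mx x 0); rewrite -[M in RHS]hsubmxK mul_row_col mulmx0 addr0.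
  + case=> x xP; apply: nlF0; exists (usubmx x) => A XA.
    have := xP _ (inl A XA); rewrite /= row_mxKl => ->.
    by rewrite -[x in LHS]vsubmxK mul_row_col mul0mx addr0.
move=> F linF rcF.
have [||x [a xP]] := clF0 (fun A => F (row_mx A 0)).
- move=> c A A' XA XA'; rewrite -linF ?inl //.
  by rewrite scale_row_mx add_row_mx scaler0 addr0.
- move=> A XA; have [x ->] := rcF _ (inl A XA); exists (usubmx x).
  by rewrite -[x in LHS]vsubmxK mul_row_col mul0mx addr0.
have [||y yP] := @rc_full_mx_local n q (fun B => F (row_mx 0 B)).
- move=> c B B' _ _; rewrite -linF ?inr //.
  by rewrite scale_row_mx add_row_mx scaler0 addr0.
- move=> B _; have [z ->] := rcF _ (inr B); exists (dsubmx z).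
  by rewrite -[z in LHS]vsubmxK mul_row_col mul0mx add0r.
exists (col_mx x y), a => M /mx_coprodP XM /=.
have -> : F M = F (row_mx (lsubmx M) 0) + F (row_mx 0 (rsubmx M)).
  rewrite -[M in LHS]hsubmxK; have := linF 1 _ _ (inl _ XM) (inr (rsubmx M)).
  by rewrite !scale1r add_row_mx addr0 add0r.
rewrite xP // yP ?mem_full_mx // -[M in X in _ = X + _]hsubmxK mul_row_col.
by rewrite addrAC.
Qed.

Definition zero_pad m n p (X : {set 'M['F_2]_(m, p)}) : {set 'M['F_2]_(m + n, p)} :=
  [set col_mx A 0 | A in X].

Lemma zero_padP m n p (X : {set 'M['F_2]_(m, p)}) (M : 'M_(m + n, p)) :
  M \in zero_pad n X <-> usubmx M \in X /\ dsubmx M = 0.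
Proof.
split=> [/imsetP[A XA ->]|[XM M0]]; first by rewrite col_mxKu col_mxKd.
by apply/imsetP; exists (usubmx M); rewrite // -M0 vsubmxK.
Qed.

(** Reading the blocks by columns: A and 0 form the zero-padded part, while C
    and B together range over all matrices with q columns. *)
Lemma vee_full_mx m n p q (X : {set 'M['F_2]_(m, p)}) :
  vee X (full_mx n q) = mx_coprod (zero_pad n X) (full_mx (m + n) q).
Proof.
apply/setP=> M; apply/idP/idP.
  rewrite inE => /exists_inP[A XA /exists_inP[B _ /existsP[C /eqP ->]]].
  by apply/mx_coprodP/zero_padP; rewrite block_mxEh row_mxKl col_mxKu col_mxKd.
move=> /mx_coprodP/zero_padP[XM M0]; rewrite inE.
apply/exists_inP; exists (usubmx (lsubmx M)) => //.
apply/exists_inP; exists (dsubmx (rsubmx M)); first exact: mem_full_mx.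
apply/existsP; exists (usubmx (rsubmx M)).
by rewrite block_mxEh -M0 !vsubmxK hsubmxK.
Qed.

(** The image of a zero-padded matrix has zero last n coordinates, hence so
    does the value of a range-compatible map. *)
Lemma one_nonlocal_zero_pad m n p (X : {set 'M['F_2]_(m, p)}) F0 :
  one_nonlocal_class X F0 ->
  one_nonlocal_class (zero_pad n X) (fun M => col_mx (F0 (usubmx M)) 0).
Proof.
move=> [addX [linF0 rcF0 nlF0] clF0]; have [X0 XD] := addX.
have inP (A : 'M_(m, p)) : A \in X -> col_mx A 0 \in zero_pad n X.
  by move=> XA; apply/zero_padP; rewrite col_mxKu col_mxKd.
split; first split.
- by apply/zero_padP; rewrite !linear0.
- move=> M N /zero_padP[XM M0] /zero_padP[XN N0].
  by apply/zero_padP; rewrite !linearD /= M0 N0 addr0 XD.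
- split.
  + move=> a M N /zero_padP[XM M0] /zero_padP[XN N0] /=.
    by rewrite linearP linF0 // scale_col_mx add_col_mx scaler0 addr0.
  + move=> M /zero_padP[XM M0]; have [x xP] := rcF0 _ XM.
    by exists x; rewrite xP -[M in RHS]vsubmxK M0 mul_col_mx mul0mx.
  + case=> x xP; apply: nlF0; exists x => A XA.
    have := xP _ (inP A XA); rewrite col_mxKu mul_col_mx => /eq_col_mx[-> _].
    by [].
move=> F linF rcF.
have [||x [a xP]] := clF0 (fun A => usubmx (F (col_mx A 0))).
- move=> c A A' XA XA'; rewrite -linearP -linF ?inP //.
  by rewrite scale_col_mx add_col_mx scaler0 addr0.
- move=> A XA; have [x ->] := rcF _ (inP A XA); exists x.
  by rewrite mul_col_mx col_mxKu.
exists x, a => M /zero_padP[XM M0].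
have defM : M = col_mx (usubmx M) 0 by rewrite -M0 vsubmxK.
have XpM : M \in zero_pad n X by rewrite defM inP.
have F0M : dsubmx (F M) = 0.
  by have [z ->] := rcF _ XpM; rewrite defM mul_col_mx col_mxKd mul0mx.
rewrite -[LHS]vsubmxK F0M {1}defM xP // [in X in _ = X + _]defM.
by rewrite mul_col_mx mul0mx scale_col_mx add_col_mx scaler0 addr0.
Qed.

Lemma one_nonlocal_vee m n p q (X : {set 'M['F_2]_(m, p)}) F0 :
  one_nonlocal_class X F0 ->
  one_nonlocal_class (vee X (full_mx n q))
    (fun M => col_mx (F0 (usubmx (lsubmx M))) 0).
Proof.
move=> clX; rewrite vee_full_mx.
exact: (one_nonlocal_coprod q (one_nonlocal_zero_pad n clX)).
Qed.

(** * From matrix spaces to operator spaces *)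

Lemma local_sub_rc (U V : vectType 'F_2) (S : {vspace 'Hom(U, V)}) : (Lloc S <= Lrc S)%VS.
Proof.
apply/subvP=> F /mem_Lloc[x xP]; apply/mem_Lrc=> s.
by rewrite xP memv_img ?memvf.
Qed.

Lemma mx_in_basesE (U V : vectType 'F_2) (e : (\dim {:U}).-tuple U)
    (f : (\dim {:V}).-tuple V) s :
  mx_in_bases e f s = (mxof e f s)^T.
Proof.
by apply/matrixP=> i j; rewrite !mxE vecof_delta.
Qed.

(** Coordinates in the bases e and f identify S with X, evaluation at a vector
    with multiplication by its column of coordinates, and so (local,
    range-compatible) maps on S with those on X.  The operator G0 attached to
    F0 then satisfies Lrc = Lloc + <[G0]>, with G0 outside Lloc. *)
Lemma represented_dim_rc (U V : vectType 'F_2) (S : {vspace 'Hom(U, V)}) n k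
    (X : {set 'M['F_2]_(n, k)}) F0 :
  one_nonlocal_class X F0 -> represented_by S X ->
  \dim (Lrc S) = (\dim (Lloc S) + 1)%N.
Proof.
move=> clX [e [f [eb fb SX]]].
have defk := size_basis eb; have defn := size_basis fb; subst n k.
have [addX [linF0 rcF0 nlF0] clF0] := clX.
pose mx (s : subvs_of S) := (mxof e f (vsval s))^T.
have Xmx s : mx s \in X.
  by apply/SX; exists (vsval s); [apply: subvsP | rewrite mx_in_basesE].
have mx_lin a s t : mx (a *: s + t) = a *: mx s + mx t.
  by rewrite /mx !linearP.
have app (s : subvs_of S) u : vsval s u = vecof f (mx s *m (rVof e u)^T)^T.
  by rewrite trmx_mul !trmxK -hom_vecof // rVofK.
pose G0f s := vecof f (F0 (mx s))^T.
have G0lin : linear G0f.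
  by move=> a s t; rewrite /G0f mx_lin linF0 // !linearP.
pose H := GRing.isLinear.Build _ _ _ _ _ G0lin.
pose L : {linear _ -> _} := HB.pack G0f H.
pose G0 := linfun L.
have G0E s : G0 s = vecof f (F0 (mx s))^T by rewrite lfunE.
have G0rc : G0 \in Lrc S.
  apply/mem_Lrc=> s; rewrite G0E; have [x ->] := rcF0 _ (Xmx s).
  have -> : x = (rVof e (vecof e x^T))^T by rewrite vecofK ?trmxK.
  by rewrite -app memv_img ?memvf.
have G0nl : G0 \notin Lloc S.
  apply/negP=> /mem_Lloc[x xP]; apply: nlF0; exists (rVof e x)^T => M /SX[s Ss <-].
  have := xP (Sub s Ss); rewrite G0E app mx_in_basesE.
  by move/(can_inj (vecofK fb))/trmx_inj; rewrite /mx SubK.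
have defLrc : (Lrc S = Lloc S + <[G0]>)%VS.
  apply/eqP; rewrite eqEsubv; apply/andP; split; last first.
    by rewrite subv_add local_sub_rc -memvE.
  apply/subvP=> G /mem_Lrc Grc.
  pose lift M := vsproj S (hommx e f M^T).
  have lift_mx s : lift (mx s) = s by rewrite /lift trmxK mxofK // vsvalK.
  have [||x [a xP]] := clF0 (fun M => (rVof f (G (lift M)))^T).
  - by move=> a M N _ _; rewrite /lift !linearP.
  - move=> M /SX[s Ss]; rewrite mx_in_basesE => defM.
    have -> : M = mx (Sub s Ss) by rewrite /mx SubK.
    rewrite lift_mx; have /memv_imgP[u _ ->] := Grc (Sub s Ss).
    by exists (rVof e u)^T; rewrite app vecofK ?trmxK.
  apply/memv_addP.
  exists (eval_at S (vecof e x^T)).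
    by apply/mem_Lloc; exists (vecof e x^T) => s; rewrite eval_atE.
  exists (a *: G0); first by rewrite memvZ ?memv_line.
  apply/lfunP=> s; rewrite add_lfunE scale_lfunE eval_atE G0E.
  have := xP _ (Xmx s); rewrite lift_mx => /(congr1 trmx); rewrite trmxK.
  move/(congr1 (vecof f)); rewrite rVofK // => ->.
by rewrite !(linearD, linearZ) /= app vecofK ?trmxK.
have capG0 : (Lloc S :&: <[G0]> = 0)%VS.
  apply/eqP; rewrite -subv0; apply/subvP=> G.
  rewrite memv_cap => /andP[Gloc /vlineP[a defG]]; rewrite memv0 defG.
  move: Gloc; rewrite defG; case: (F2_cases a) => ->; first by rewrite scale0r.
  by rewrite scale1r (negPf G0nl).
rewrite defLrc dimv_disjoint_sum // dim_vline; congr (_ + _)%N.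
by apply/eqP; rewrite eqb1; apply: contraNneq G0nl => ->; apply: mem0v.
Qed.

(** * The finite verification *)

(** Vectors and matrices over the two-element field are encoded by lists of
    booleans so that the verification below is an evaluation.  Entries beyond
    the end of a list are read as 0, which makes the encoding total. *)
Definition xorsum n (f : nat -> bool) := foldr (fun i => addb (f i)) false (iota 0 n).

Lemma xorsumE n f : (xorsum n f)%:R = \sum_(i < n) (f i)%:R :> 'F_2.
Proof.
rewrite -(big_mkord xpredT (fun i => (f i)%:R)) /xorsum /index_iota subn0.
elim: (iota 0 n) => [|i s IHs]; first by rewrite big_nil.
by rewrite big_cons -IHs -natr_addb.
Qed.

Fixpoint words T (A : seq T) n :=
  if n is n'.+1 then [seq a :: w | a <- A, w <- words A n'] else [:: [::]].

Lemma mem_words (T : eqType) (A : seq T) n w :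
  size w = n -> {subset w <= A} -> w \in words A n.
Proof.
elim: n w => [|n IHn] [|a w] //= [sz_w] sAw.
apply: allpairs_f; first by rewrite sAw ?mem_head.
by apply: IHn => // b wb; rewrite sAw // inE wb orbT.
Qed.

Definition bitvecs n := words [:: false; true] n.
Definition bitmxs n k := words (bitvecs k) n.

Lemma mem_bitvecs n w : size w = n -> w \in bitvecs n.
Proof. by move=> sz_w; apply: mem_words => // -[]. Qed.

Definition bit (B : seq bitseq) i j := nth false (nth [::] B i) j.

Definition row_of_bits n (y : bitseq) : 'rV['F_2]_n := \row_i (nth false y i)%:R.
Definition mx_of_bits n k (B : seq bitseq) : 'M['F_2]_(n, k) :=
  \matrix_(i, j) (bit B i j)%:R.

Definition bits_of_row n (y : 'rV['F_2]_n) : bitseq :=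
  [seq y 0 i != 0 | i <- enum 'I_n].

Lemma size_bits_of_row n (y : 'rV_n) : size (bits_of_row y) = n.
Proof. by rewrite size_map size_enum_ord. Qed.

Lemma nth_bits_of_row n (y : 'rV_n) (i : 'I_n) :
  nth false (bits_of_row y) i = (y 0 i != 0).
Proof. by rewrite (nth_map i) ?size_enum_ord // nth_ord_enum. Qed.

Lemma bits_of_rowK n : cancel (@bits_of_row n) (row_of_bits n).
Proof. by move=> y; apply/rowP=> i; rewrite mxE nth_bits_of_row F2_bool. Qed.

Definition bits_of_mx n k (M : 'M['F_2]_(n, k)) : seq bitseq :=
  [seq bits_of_row (row i M) | i <- enum 'I_n].

Lemma nth_bits_of_mx n k (M : 'M_(n, k)) (i : 'I_n) :
  nth [::] (bits_of_mx M) i = bits_of_row (row i M).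
Proof. by rewrite (nth_map i) ?size_enum_ord // nth_ord_enum. Qed.

Lemma bits_of_mxK n k : cancel (@bits_of_mx n k) (mx_of_bits n k).
Proof.
move=> M; apply/matrixP=> i j.
by rewrite mxE /bit nth_bits_of_mx nth_bits_of_row mxE F2_bool.
Qed.

Lemma mem_bitmxs n k (M : 'M_(n, k)) : bits_of_mx M \in bitmxs n k.
Proof.
apply: mem_words => [|_ /mapP[i _ ->]]; first by rewrite size_map size_enum_ord.
by rewrite mem_bitvecs ?size_bits_of_row.
Qed.

Section Certificate.
Variables n k : nat.

(** The linear form in M given by y and G, namely y *m rowwise G M
    ([pairingE]); the verification only ever compares such forms. *)
Definition pairing (y : bitseq) (G M : seq bitseq) : bool :=
  xorsum n (fun i => nth false y i && xorsum k (fun j => bit G i j && bit M i j)).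

(** Adding x to every row of G adds the local map at x; in particular
    [shift x [::]] is that local map. *)
Definition shift (x : bitseq) (G : seq bitseq) : seq bitseq :=
  mkseq (fun i => mkseq (fun j => bit G i j (+) nth false x j) k) n.

Variable gens : seq (seq bitseq).

Definition agree y G G' := all (fun M => pairing y G M == pairing y G' M) gens.

Definition agree_all G G' := all (fun y => agree y G G') (bitvecs n).

(** The duality criterion: for every y, the form given by y and G agrees on X
    with the one given by y and some local map. *)
Definition rc_bits G :=
  all (fun y => has (fun g => agree y G (shift g [::])) (bitvecs k)) (bitvecs n).

(** Modulo local maps the first row of G can be assumed to vanish, which leaves
    2^(k(n-1)) candidates.  Most searches stop early, so lazy evaluation is
    fast where call-by-value would explore every branch. *)
Definition certificate G0 :=
  [&& rc_bits G0, ~~ has (fun g => agree_all G0 (shift g [::])) (bitvecs k)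
    & all (fun G => (nth [::] G 0 == nseq k false) && rc_bits G ==>
         has (fun x => agree_all G (shift x [::]) || agree_all G (shift x G0))
             (bitvecs k))
        (bitmxs n k)].

Lemma pairingE y G M :
  (pairing y G M)%:R%:M
    = row_of_bits n y *m rowwise (mx_of_bits n k G) (mx_of_bits n k M).
Proof.
apply/matrixP=> i j; rewrite !ord1 !mxE xorsumE; apply: eq_bigr => l _.
rewrite !mxE -mulnb natrM xorsumE; congr (_ * _); apply: eq_bigr => s _.
by rewrite !mxE -mulnb natrM.
Qed.

Lemma mx_of_bits_shift x G :
  mx_of_bits n k (shift x G) = mx_of_bits n k G + \matrix_(i < n) row_of_bits k x.
Proof.
by apply/matrixP=> i j; rewrite !mxE /bit !nth_mkseq // natr_addb.
Qed.

Lemma mx_of_bits0 : mx_of_bits n k [::] = 0.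
Proof. by apply/matrixP=> i j; rewrite !mxE /bit nth_nil nth_nil. Qed.

Variable X : {set 'M['F_2]_(n, k)}.
Hypothesis spanX : forall M, M \in X <-> exists t : nat -> 'F_2,
  M = \sum_(l < size gens) t l *: mx_of_bits n k (nth [::] gens l).

Lemma gen_in_span B : B \in gens -> mx_of_bits n k B \in X.
Proof.
case/(nthP [::]) => l lt_l <-; apply/spanX; exists (fun i => (i == l)%:R).
rewrite (bigD1 (Ordinal lt_l)) //= eqxx scale1r big1 ?addr0 // => i ne_il.
by rewrite (_ : (i == l :> nat) = false) ?scale0r //; apply/negbTE.
Qed.

Lemma additive_span : additive_set X.
Proof.
split; first by apply/spanX; exists (fun=> 0); rewrite big1 // => i _; rewrite scale0r.
move=> _ _ /spanX[t ->] /spanX[u ->]; apply/spanX; exists (fun l => t l + u l).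
by rewrite -big_split; apply: eq_bigr => l _; rewrite scalerDl.
Qed.

(** Both sides are additive in M, so generators of X suffice. *)
Lemma agreeP y G G' :
  reflect {in X, forall M, row_of_bits n y *m rowwise (mx_of_bits n k G) M
                         = row_of_bits n y *m rowwise (mx_of_bits n k G') M}
          (agree y G G').
Proof.
apply: (iffP allP) => [eqG _ /spanX[t ->]|eqG B gensB].
  elim/big_rec: _ => [|l M _ eqM].
    by rewrite !rowwise_0r.
  rewrite !rowwise_is_linear !mulmxDr eqM -!scalemxAr -!pairingE.
  by rewrite (eqP (eqG _ (mem_nth _ _))).
have := eqG _ (gen_in_span gensB); rewrite -!pairingE.
move/matrixP/(_ 0 0); rewrite !mxE eqxx !mulr1n.
by case: (pairing y G B); case: (pairing y G' B).
Qed.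

Lemma agree_allP G G' :
  reflect {in X, rowwise (mx_of_bits n k G) =1 rowwise (mx_of_bits n k G')}
          (agree_all G G').
Proof.
apply: (iffP allP) => [eqG M XM|eqG y _]; last first.
  by apply/agreeP=> M XM; rewrite eqG.
apply/colP=> i.
have /agreeP/(_ M XM) := eqG _ (mem_bitvecs (size_bits_of_row (delta_mx 0 i))).
by rewrite bits_of_rowK -!rowE => /rowP/(_ 0); rewrite !mxE.
Qed.

Lemma rowwise_shift x G M :
  rowwise (mx_of_bits n k (shift x G)) M
    = rowwise (mx_of_bits n k G) M + M *m (row_of_bits k x)^T.
Proof. by rewrite mx_of_bits_shift rowwiseDl rowwise_const. Qed.

Lemma rowwise_shift0 x M :
  rowwise (mx_of_bits n k (shift x [::])) M = M *m (row_of_bits k x)^T.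
Proof. by rewrite rowwise_shift mx_of_bits0 rowwise_0l add0r. Qed.

(** A range-compatible map passes the test by [functional_factor]; conversely,
    if y M = 0 then y M g = 0 for the g found by the test, so that
    [col_in_image] applies. *)
Lemma rc_bitsP G :
  reflect (mx_range_compatible X (rowwise (mx_of_bits n k G))) (rc_bits G).
Proof.
apply: (iffP allP) => [rcG M XM|rcG y _].
  apply: col_in_image => y yM.
  have /hasP[g _ /agreeP/(_ M XM)] := rcG _ (mem_bitvecs (size_bits_of_row y)).
  by rewrite bits_of_rowK rowwise_shift0 mulmxA yM mul0mx.
have linG := @rowwise_linear_on _ _ (mx_of_bits n k G) X.
have [g gP] := functional_factor additive_span linG rcG (row_of_bits n y).
apply/hasP; exists (bits_of_row g^T).
  by rewrite mem_bitvecs ?size_bits_of_row.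
by apply/agreeP=> M XM; rewrite rowwise_shift0 bits_of_rowK trmxK mulmxA gP.
Qed.

End Certificate.

(** A range-compatible F is given by a matrix G; subtracting the local map given
    by the first row of G puts it among the matrices searched by the
    certificate. *)
Lemma certificate_sound n k gens (X : {set 'M['F_2]_(n.+1, k)}) G0 :
  (forall M, M \in X <-> exists t : nat -> 'F_2,
     M = \sum_(l < size gens) t l *: mx_of_bits n.+1 k (nth [::] gens l)) ->
  certificate n.+1 k gens G0 -> one_nonlocal_class X (rowwise (mx_of_bits n.+1 k G0)).
Proof.
move=> spanX /and3P[/(rc_bitsP spanX) rcG0 nlG0 /allP clG0].
have addX := additive_span spanX.
split=> //; first split=> //.
- exact: rowwise_linear_on.
- case=> x xP; case/hasP: nlG0; exists (bits_of_row x^T).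
    by rewrite mem_bitvecs ?size_bits_of_row.
  by apply/(agree_allP spanX) => M XM; rewrite rowwise_shift0 bits_of_rowK trmxK xP.
move=> F linF rcF; have [G defF] := rc_rowwise addX linF rcF.
pose G' := G - \matrix_(i < n.+1) row 0 G.
have defG' M : M \in X -> rowwise G' M = F M - M *m (row 0 G)^T.
  move=> XM; apply/(canRL (addrK _)).
  by rewrite -rowwise_const -rowwiseDl subrK -defF.
have := clG0 _ (mem_bitmxs G') => /=; case: andP => [_ /=|norm0]; last first.
  case: norm0; split.
    rewrite (nth_bits_of_mx _ 0); apply/eqP/(@eq_from_nth _ false).
      by rewrite size_bits_of_row size_nseq.
    rewrite size_bits_of_row => i lt_i.
    by rewrite nth_nseq lt_i (nth_bits_of_row _ (Ordinal lt_i)) !mxE subrr eqxx.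
  apply/(rc_bitsP spanX) => M XM; rewrite bits_of_mxK defG' //.
  by have [x ->] := rcF M XM; exists (x - (row 0 G)^T); rewrite mulmxBr.
move=> /hasP[x _ agreeG']; exists ((row_of_bits k x)^T + (row 0 G)^T).
case/orP: agreeG' => /(agree_allP spanX); rewrite bits_of_mxK => G'E.
  exists 0 => M XM; have := G'E M XM; rewrite rowwise_shift0 defG' //.
  by rewrite scale0r addr0 mulmxDr => <-; rewrite subrK.
exists 1 => M XM; have := G'E M XM; rewrite rowwise_shift defG' //.
move/(canRL (subrK _)) => ->.
by rewrite scale1r mulmxDr -addrA addrC.
Qed.

(** * Matrix spaces given by a pattern of parameters *)

Lemma mx_ent n k (M : 'M_(n.+1, k.+1)) (i : 'I_n.+1) (j : 'I_k.+1) :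
  M i j = ent M i.+1 j.+1.
Proof. by rewrite /ent !inord_val. Qed.

Lemma ent_sym n (M : 'M_n.+1) i j : M \in sym_mx n.+1 -> ent M i j = ent M j i.
Proof. by rewrite inE => /eqP symM; rewrite /ent -[in LHS]symM mxE. Qed.

Lemma rowwise_mx_of_bits n k G (M : 'M_(n.+1, k.+1)) :
  rowwise (mx_of_bits n.+1 k.+1 G) M
    = cV_of n.+1
        (mkseq (fun i => \sum_(j <- iota 0 k.+1 | bit G i j) ent M i.+1 j.+1) n.+1).
Proof.
apply/colP=> i; rewrite !mxE nth_mkseq //.
rewrite -[iota 0 k.+1]/(index_iota 0 k.+1) big_mkord [RHS]big_mkcond.
apply: eq_bigr => j _; rewrite mxE -mx_ent.
by case: (bit G i j); rewrite (mul1r, mul0r).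
Qed.

(** A pattern lists, entry by entry, the indices of the parameters whose sum is
    that entry.  The generators of the space are obtained by setting one
    parameter to 1 and the others to 0. *)
Definition pattern := seq (seq (seq nat)).

Definition pattern_mx n k (P : pattern) (t : nat -> 'F_2) : 'M['F_2]_(n, k) :=
  mx_of_rows n k [seq [seq \sum_(l <- ls) t l | ls <- r] | r <- P].

Definition pattern_gens (P : pattern) d : seq (seq bitseq) :=
  mkseq (fun l => [seq [seq l \in ls | ls <- r] | r <- P]) d.

Definition pattern_wf (P : pattern) d : bool :=
  all (all (fun ls => uniq ls && all (ltn^~ d) ls)) P.

Lemma nth_map_default T1 T2 (f : T1 -> T2) x y s i :
  f x = y -> nth y (map f s) i = f (nth x s i).
Proof. by move=> <-; elim: s i => [|a s IHs] [|i] /=. Qed.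

Lemma all_nth_default T (a : pred T) x s i : a x -> all a s -> a (nth x s i).
Proof. by move=> ax; elim: s i => [|b s IHs] [|i] //= /andP[ab //]; apply: IHs. Qed.

Lemma sum_pattern_gens n k P d (t : nat -> 'F_2) : pattern_wf P d ->
  \sum_(l < size (pattern_gens P d))
      t l *: mx_of_bits n k (nth [::] (pattern_gens P d) l) = pattern_mx n k P t.
Proof.
rewrite size_mkseq => wfP; apply/matrixP=> i j; rewrite summxE mxE.
pose ls := nth [::] (nth [::] P i) j.
have /andP[uniq_ls ls_lt] : uniq ls && all (ltn^~ d) ls.
  rewrite /ls; apply: (@all_nth_default _ (fun ls => uniq ls && all (ltn^~ d) ls)) => //.
  exact: all_nth_default wfP.
rewrite (nth_map_default (x := [::])) // (nth_map_default (x := [::])) ?big_nil // -/ls.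
transitivity (\sum_(0 <= l < d | l \in ls) t l).
  rewrite big_mkord [RHS]big_mkcond; apply: eq_bigr => l _.
  rewrite !mxE nth_mkseq // /bit (nth_map_default (x := [::])) //.
  rewrite (nth_map_default (x := [::])) // -/ls.
  by case: (_ \in _); rewrite (mulr0, mulr1).
rewrite -big_filter; apply/perm_big/uniq_perm; rewrite ?filter_uniq ?iota_uniq //.
move=> l; rewrite mem_filter mem_index_iota /=; case: (boolP (l \in ls)) => //= ls_l.
exact: (allP ls_lt l ls_l).
Qed.

Lemma certified_pattern n k P d (X : {set 'M['F_2]_(n.+1, k)}) G0 :
    (forall M, M \in X <-> exists t, M = pattern_mx n.+1 k P t) ->
    pattern_wf P d && certificate n.+1 k (pattern_gens P d) G0 ->
  one_nonlocal_class X (rowwise (mx_of_bits n.+1 k G0)).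
Proof.
move=> XP /andP[wfP]; apply: certificate_sound => M; rewrite XP.
by split=> -[t ->]; exists t; rewrite sum_pattern_gens.
Qed.

Lemma ent_pattern_mx n k P t i j : (i < n.+1)%N -> (j < k.+1)%N ->
  ent (pattern_mx n.+1 k.+1 P t) i.+1 j.+1 = \sum_(l <- nth [::] (nth [::] P i) j) t l.
Proof.
move=> lt_i lt_j; rewrite /ent !mxE !inordK //.
by rewrite (nth_map_default (x := [::])) // (nth_map_default (x := [::])) ?big_nil.
Qed.

Ltac expand_pattern := rewrite /pattern_mx /= !big_cons !big_nil !addr0 ?addrA.
Ltac expand_rowwise :=
  rewrite rowwise_mx_of_bits /mkseq /= !big_cons !big_nil /bit /= ?addr0.
Ltac witness t l := apply/existsP; exists (t l).

(** * The seven special spaces *)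

(** The parameters a, b, c, ... of the displayed matrices are numbered 0, 1,
    2, ... in the patterns.  In each certificate the last list is the matrix G0
    of coefficients of the example, where missing entries are 0. *)
Definition S2_pattern : pattern :=
  [:: [:: [:: 0]; [:: 1]];
      [:: [:: 1]; [:: 2]]]%N.

Lemma S2_patternP M :
  M \in sym_mx 2 <-> exists t, M = pattern_mx 2 2 S2_pattern t.
Proof.
split=> [symM|[t ->]].
  exists (nth 0 [:: ent M 1 1; ent M 1 2; ent M 2 2]); expand_pattern.
  apply/matrixP; case=> [[|[|?]] ?] //; case=> [[|[|?]] ?] //;
  by rewrite mxE mx_ent /= ?(ent_sym 2 1 symM)%N.
expand_pattern; rewrite inE; apply/eqP/matrixP=> i j; rewrite !mxE.
by case: i j => [[|[|?]] ?] // [[|[|?]] ?].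
Qed.

Lemma S2_class : one_nonlocal_class (sym_mx 2)
  (fun M : 'M_(2, 2) => cV_of 2 [:: ent M 1 1; ent M 2 2]).
Proof.
have cert : pattern_wf S2_pattern 3 &&
    certificate 2 2 (pattern_gens S2_pattern 3)
      [:: [:: true; false]; [:: false; true]].
  by lazy.
apply: eq_one_nonlocal_class (certified_pattern S2_patternP cert) => {cert} M _.
by expand_rowwise.
Qed.

Definition S3_pattern : pattern :=
  [:: [:: [:: 0]; [:: 1]; [:: 2]];
      [:: [:: 1]; [:: 3]; [:: 4]];
      [:: [:: 2]; [:: 4]; [:: 5]]]%N.

Lemma S3_patternP M :
  M \in sym_mx 3 <-> exists t, M = pattern_mx 3 3 S3_pattern t.
Proof.
split=> [symM|[t ->]].
  exists (nth 0 [:: ent M 1 1; ent M 1 2; ent M 1 3; ent M 2 2; ent M 2 3; ent M 3 3]).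
  expand_pattern; apply/matrixP.
  case=> [[|[|[|?]]] ?] //; case=> [[|[|[|?]]] ?] //; rewrite mxE mx_ent //=;
  by rewrite (ent_sym 2 1 symM, ent_sym 3 1 symM, ent_sym 3 2 symM)%N.
expand_pattern; rewrite inE; apply/eqP/matrixP=> i j; rewrite !mxE.
by case: i j => [[|[|[|?]]] ?] // [[|[|[|?]]] ?].
Qed.

Lemma S3_class : one_nonlocal_class (sym_mx 3)
  (fun M : 'M_(3, 3) => cV_of 3 [:: ent M 1 1; ent M 2 2; ent M 3 3]).
Proof.
have cert : pattern_wf S3_pattern 6 &&
    certificate 3 3 (pattern_gens S3_pattern 6)
      [:: [:: true; false; false]; [:: false; true; false]; [:: false; false; true]].
  by lazy.
apply: eq_one_nonlocal_class (certified_pattern S3_patternP cert) => {cert} M _.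
by expand_rowwise.
Qed.

Definition V2_pattern : pattern :=
  [:: [:: [:: 0]; [:: 1]];
      [:: [:: 1]; [:: 2]];
      [:: [:: 2]; [::]]]%N.

Lemma V2_patternP M :
  M \in V2 <-> exists t, M = pattern_mx 3 2 V2_pattern t.
Proof.
rewrite inE; split.
  case/existsP=> a /existsP[b /existsP[c /eqP ->]].
  by exists (nth 0 [:: a; b; c]); expand_pattern.
case=> t ->.
witness t 0%N; witness t 1%N; witness t 2%N.
by apply/eqP; expand_pattern.
Qed.

Lemma V2_class : one_nonlocal_class V2
  (fun M : 'M_(3, 2) => cV_of 3 [:: 0; ent M 2 1 + ent M 2 2; 0]).
Proof.
have cert : pattern_wf V2_pattern 3 &&
    certificate 3 2 (pattern_gens V2_pattern 3)
      [:: [::]; [:: true; true]].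
  by lazy.
apply: eq_one_nonlocal_class (certified_pattern V2_patternP cert) => {cert} M _.
by expand_rowwise.
Qed.

Definition G3_pattern : pattern :=
  [:: [:: [:: 0]; [:: 2]; [:: 1]];
      [:: [::]; [:: 1; 2]; [:: 4]];
      [:: [:: 1]; [:: 3]; [:: 5]]]%N.

Lemma G3_patternP M :
  M \in G3 <-> exists t, M = pattern_mx 3 3 G3_pattern t.
Proof.
rewrite inE; split.
  case/existsP=> a /existsP[b /existsP[c /existsP[d /existsP[e /existsP[f /eqP ->]]]]].
  by exists (nth 0 [:: a; b; c; d; e; f]); expand_pattern.
case=> t ->.
witness t 0%N; witness t 1%N; witness t 2%N.
witness t 3%N; witness t 4%N; witness t 5%N.
by apply/eqP; expand_pattern.
Qed.

Lemma G3_class : one_nonlocal_class G3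
  (fun M : 'M_(3, 3) => cV_of 3 [:: ent M 1 1 + ent M 1 3; 0; 0]).
Proof.
have cert : pattern_wf G3_pattern 6 &&
    certificate 3 3 (pattern_gens G3_pattern 6)
      [:: [:: true; false; true]].
  by lazy.
apply: eq_one_nonlocal_class (certified_pattern G3_patternP cert) => {cert} M _.
by expand_rowwise.
Qed.

Definition H3_pattern : pattern :=
  [:: [:: [:: 0]; [:: 1]; [:: 2]];
      [:: [:: 1]; [:: 3]; [:: 5]];
      [:: [:: 2]; [:: 4]; [:: 1; 2; 3]]]%N.

Lemma H3_patternP M :
  M \in H3 <-> exists t, M = pattern_mx 3 3 H3_pattern t.
Proof.
rewrite inE; split.
  case/existsP=> a /existsP[b /existsP[c /existsP[d /existsP[e /existsP[f /eqP ->]]]]].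
  by exists (nth 0 [:: a; b; c; d; e; f]); expand_pattern.
case=> t ->.
witness t 0%N; witness t 1%N; witness t 2%N.
witness t 3%N; witness t 4%N; witness t 5%N.
by apply/eqP; expand_pattern.
Qed.

Lemma H3_class : one_nonlocal_class H3
  (fun M : 'M_(3, 3) => cV_of 3 [:: ent M 1 1; ent M 2 2; ent M 3 3]).
Proof.
have cert : pattern_wf H3_pattern 6 &&
    certificate 3 3 (pattern_gens H3_pattern 6)
      [:: [:: true; false; false]; [:: false; true; false]; [:: false; false; true]].
  by lazy.
apply: eq_one_nonlocal_class (certified_pattern H3_patternP cert) => {cert} M _.
by expand_rowwise.
Qed.

Definition I3_pattern : pattern :=
  [:: [:: [:: 0]; [:: 3]; [:: 4]];
      [:: [:: 1]; [:: 2]; [:: 5]];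
      [:: [:: 2]; [:: 0]; [:: 0; 2; 4; 5]]]%N.

Lemma I3_patternP M :
  M \in I3 <-> exists t, M = pattern_mx 3 3 I3_pattern t.
Proof.
rewrite inE; split.
  case/existsP=> a /existsP[b /existsP[c /existsP[d /existsP[e /existsP[f /eqP ->]]]]].
  by exists (nth 0 [:: a; b; c; d; e; f]); expand_pattern.
case=> t ->.
witness t 0%N; witness t 1%N; witness t 2%N.
witness t 3%N; witness t 4%N; witness t 5%N.
by apply/eqP; expand_pattern.
Qed.

(** On this space m_{3,2} = m_{1,1}, so the example only involves the entries of
    row 3, as [rc_rowwise] requires. *)
Lemma I3_class : one_nonlocal_class I3
  (fun M : 'M_(3, 3) => cV_of 3 [:: 0; 0; ent M 1 1 + ent M 3 1]).
Proof.
have cert : pattern_wf I3_pattern 6 &&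
    certificate 3 3 (pattern_gens I3_pattern 6)
      [:: [::]; [::]; [:: true; true]].
  by lazy.
apply: eq_one_nonlocal_class (certified_pattern I3_patternP cert).
move=> {cert} M /I3_patternP[t defM].
have e32 : ent M 3 2 = ent M 1 1 by rewrite defM !ent_pattern_mx // !big_seq1.
by expand_rowwise; rewrite e32 addrC.
Qed.

Definition H4_pattern : pattern :=
  [:: [:: [:: 0]; [:: 1; 2]; [:: 5]; [:: 7]];
      [:: [:: 1]; [:: 3]; [:: 0; 2]; [:: 8]];
      [:: [:: 2]; [:: 4]; [:: 6]; [:: 0; 1]]]%N.

Lemma H4_patternP M :
  M \in H4 <-> exists t, M = pattern_mx 3 4 H4_pattern t.
Proof.
rewrite inE; split.
  case/existsP=> a /existsP[b /existsP[c /existsP[d /existsP[e]]]].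
  case/existsP=> f /existsP[g /existsP[h /existsP[i /eqP ->]]].
  by exists (nth 0 [:: a; b; c; d; e; f; g; h; i]); expand_pattern.
case=> t ->.
witness t 0%N; witness t 1%N; witness t 2%N.
witness t 3%N; witness t 4%N; witness t 5%N.
witness t 6%N; witness t 7%N; witness t 8%N.
by apply/eqP; expand_pattern.
Qed.

(** Coordinate i of the example is m_{1,1} + m_{2,1} + m_{3,1}, which the
    relations of the space express through row i: it is m_{i,1} plus the entry
    of row i that is the sum of the other two. *)
Lemma H4_class : one_nonlocal_class H4
  (fun M : 'M_(3, 4) => (ent M 1 1 + ent M 2 1 + ent M 3 1) *: cV_of 3 [:: 1; 1; 1]).
Proof.
have cert : pattern_wf H4_pattern 9 &&
    certificate 3 4 (pattern_gens H4_pattern 9)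
      [:: [:: true; true]; [:: true; false; true]; [:: true; false; false; true]].
  by lazy.
apply: eq_one_nonlocal_class (certified_pattern H4_patternP cert).
move=> {cert} M /H4_patternP[t defM].
have [e12 e23 e34] : [/\ ent M 1 2 = ent M 2 1 + ent M 3 1,
    ent M 2 3 = ent M 1 1 + ent M 3 1 & ent M 3 4 = ent M 1 1 + ent M 2 1].
  by rewrite defM !ent_pattern_mx // !(big_cons, big_nil) !addr0.
expand_rowwise; rewrite e12 e23 e34.
by apply/colP; case=> [[|[|[|?]]] ?] //; rewrite !mxE /=; ring.
Qed.

(** * Conclusion *)

Lemma ent_lsubmx n k p (M : 'M_(n.+1, k.+1 + p)) i j :
  (j < k.+1)%N -> ent (lsubmx M) i j.+1 = @ent n (k + p) M i j.+1.
Proof.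
move=> lt_j; rewrite /ent mxE; congr (M _ _); apply: val_inj => /=.
by rewrite !inordK // (leq_trans lt_j) // ltnS leq_addr.
Qed.

Lemma ent_usubmx n k p (M : 'M_(n.+1 + p, k.+1)) i j :
  (i < n.+1)%N -> ent (usubmx M) i.+1 j = @ent (n + p) k M i.+1 j.
Proof.
move=> lt_i; rewrite /ent mxE; congr (M _ _); apply: val_inj => /=.
by rewrite !inordK // (leq_trans lt_i) // ltnS leq_addr.
Qed.

Lemma one_nonlocal_dim (U V : vectType 'F_2) (S : {vspace 'Hom(U, V)}) n k
    (X : {set 'M['F_2]_(n, k)}) F0 :
  one_nonlocal_class X F0 -> represented_by S X ->
  (Lloc S <= Lrc S)%VS /\ \dim (Lrc S) = (\dim (Lloc S) + 1)%N.
Proof.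
by move=> clX repS; split; [apply: local_sub_rc | apply: represented_dim_rc clX repS].
Qed.

Lemma nonlocal_coprod n p q (X : {set 'M['F_2]_(n, p)}) F0 F1 :
  one_nonlocal_class X F0 -> (forall M, F0 (lsubmx M) = F1 M) ->
  nonlocal_rc_linear (mx_coprod X (full_mx n q)) F1.
Proof.
move=> clX eqF.
have clq := one_nonlocal_coprod q clX.
by have [] := eq_one_nonlocal_class (fun M _ => eqF M) clq.
Qed.

Lemma nonlocal_vee m n p q (X : {set 'M['F_2]_(m, p)}) F0 F1 :
  one_nonlocal_class X F0 ->
  (forall M, col_mx (F0 (usubmx (lsubmx M))) 0 = F1 M) ->
  nonlocal_rc_linear (vee X (full_mx n q)) F1.
Proof.
move=> clX eqF.
have clq := one_nonlocal_vee n q clX.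
by have [] := eq_one_nonlocal_class (fun M _ => eqF M) clq.
Qed.

Theorem theorem1p7 :
  (forall (U V : vectType 'F_2) (S : {vspace 'Hom(U, V)}),
     type1 S \/ type2 S \/ type3 S \/ type4 S \/ type5 S \/ type6 S \/ type7 S ->
     (Lloc S <= Lrc S)%VS /\ \dim (Lrc S) = (\dim (Lloc S) + 1)%N)
  /\ (forall n p : nat,
        nonlocal_rc_linear (vee (sym_mx 2) (full_mx n p))
          (fun M : 'M['F_2]_(2 + n, 2 + p) =>
             col_mx (cV_of 2 [:: ent M 1 1; ent M 2 2]) (0 : 'cV_n)))
  /\ (forall p : nat,
        nonlocal_rc_linear (mx_coprod (sym_mx 3) (full_mx 3 p))
          (fun M : 'M['F_2]_(3, 3 + p) =>
             cV_of 3 [:: ent M 1 1; ent M 2 2; ent M 3 3]))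
  /\ (forall n p : nat,
        nonlocal_rc_linear (vee V2 (full_mx n p))
          (fun M : 'M['F_2]_(3 + n, 2 + p) =>
             col_mx (cV_of 3 [:: 0; ent M 2 1 + ent M 2 2; 0]) (0 : 'cV_n)))
  /\ (forall p : nat,
        nonlocal_rc_linear (mx_coprod G3 (full_mx 3 p))
          (fun M : 'M['F_2]_(3, 3 + p) =>
             cV_of 3 [:: ent M 1 1 + ent M 1 3; 0; 0]))
  /\ (forall p : nat,
        nonlocal_rc_linear (mx_coprod H3 (full_mx 3 p))
          (fun M : 'M['F_2]_(3, 3 + p) =>
             cV_of 3 [:: ent M 1 1; ent M 2 2; ent M 3 3]))
  /\ (forall p : nat,
        nonlocal_rc_linear (mx_coprod I3 (full_mx 3 p))
          (fun M : 'M['F_2]_(3, 3 + p) =>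
             cV_of 3 [:: 0; 0; ent M 1 1 + ent M 3 1]))
  /\ (forall p : nat,
        nonlocal_rc_linear (mx_coprod H4 (full_mx 3 p))
          (fun M : 'M['F_2]_(3, 4 + p) =>
             (ent M 1 1 + ent M 2 1 + ent M 3 1) *: cV_of 3 [:: 1; 1; 1])).
Proof.
split.
  move=> U V S; case=> [[n [p]]|].
    exact: one_nonlocal_dim (one_nonlocal_vee n p S2_class).
  case=> [[p]|]; first exact: one_nonlocal_dim (one_nonlocal_coprod p S3_class).
  case=> [[n [p]]|]; first exact: one_nonlocal_dim (one_nonlocal_vee n p V2_class).
  case=> [[p]|]; first exact: one_nonlocal_dim (one_nonlocal_coprod p G3_class).
  case=> [[p]|]; first exact: one_nonlocal_dim (one_nonlocal_coprod p H3_class).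
  case=> [[p]|[p]]; first exact: one_nonlocal_dim (one_nonlocal_coprod p I3_class).
  exact: one_nonlocal_dim (one_nonlocal_coprod p H4_class).
split=> [n p|].
  by apply: (nonlocal_vee S2_class) => M; rewrite !ent_usubmx // !ent_lsubmx.
split=> [p|]; first by apply: (nonlocal_coprod S3_class) => M; rewrite !ent_lsubmx.
split=> [n p|].
  by apply: (nonlocal_vee V2_class) => M; rewrite !ent_usubmx // !ent_lsubmx.
split=> [p|]; first by apply: (nonlocal_coprod G3_class) => M; rewrite !ent_lsubmx.
split=> [p|]; first by apply: (nonlocal_coprod H3_class) => M; rewrite !ent_lsubmx.
split=> p; first by apply: (nonlocal_coprod I3_class) => M; rewrite !ent_lsubmx.
by apply: (nonlocal_coprod H4_class) => M; rewrite !ent_lsubmx.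
Qed.
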